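(* Let $n \ge 5$ and $k \ge 4$ be integers, and let $B(n,k)$ be the $(n,k)$-banana tree. Then $\mathrm{rn}(B(n,k)) = n(k+6)+1$.
   Context: A $k$-star is a tree consisting of $k$ leaves and one further vertex adjacent to all of them. The $(n,k)$-banana tree $B(n,k)$ is obtained from $n$ disjoint copies of a $(k-1)$-star and one additional root vertex by joining one leaf of each copy to the root by an edge. For a connected graph $G$, a radio labeling is a map $f: V(G) \to \{0,1,2,\ldots\}$ with $d(u,v) + |f(u)-f(v)| \ge \mathrm{diam}(G)+1$ for all distinct $u,v$, where $d$ is the graph distance; its span is $\max\{|f(u)-f(v)| : u,v \in V(G)\}$, and the radio number $\mathrm{rn}(G)$ is the minimum span over all radio labelings of $G$. *)

(* Defs.v *)
From mathcomp Require Import all_boot all_order all_algebra.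
From mathcomp Require Import boolp.

Set Implicit Arguments.
Unset Strict Implicit.
Unset Printing Implicit Defensive.

(* A simple graph is a symmetric irreflexive relation on a finType. *)

Section Radio.
Variables (T : finType) (e : rel T).

Definition walkb (u v : T) (l : nat) : bool :=
  [exists p : l.-tuple T, path e u p && (last u p == v)].

(* Length of a shortest walk. The search stops below #|T|, which loses nothing
   because a shortest walk has no repeated vertex; for vertices in different
   components the value is the junk #|T|. See gdistP and gdist_min. *)
Definition gdist (u v : T) : nat := find (walkb u v) (iota 0 #|T|).

Definition diam : nat := \max_(u : T) \max_(v : T) gdist u v.

Definition radio_labeling (f : T -> nat) : Prop :=
  forall u v : T, u != v -> diam + 1 <= gdist u v + `|f u - f v|.

Definition label_span (f : T -> nat) : nat := \max_(u : T) \max_(v : T) `|f u - f v|.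

Lemma walkbP (u v : T) (l : nat) :
  reflect (exists p : seq T, [/\ path e u p, last u p = v & size p = l])
          (walkb u v l).
Proof.
apply: (iffP existsP) => [[p /andP[ep /eqP lp]]|[p [ep lp /eqP sp]]].
  by exists p; rewrite size_tuple.
by exists (Tuple sp); rewrite /= ep lp eqxx.
Qed.

Lemma gdist_min (u v : T) (p : seq T) :
  path e u p -> last u p = v -> gdist u v <= size p.
Proof.
move=> ep lp; rewrite /gdist leqNgt; apply/negP => lt_p.
have lt_pT : size p < #|T|.
  by apply: leq_trans lt_p _; rewrite -{2}(size_iota 0 #|T|) find_size.
have := before_find 0 lt_p; rewrite nth_iota // add0n.
by move/negbT/walkbP; apply; exists p.
Qed.

Lemma gdistP (u v : T) : connect e u v ->
  exists p : seq T, [/\ path e u p, last u p = v & size p = gdist u v].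
Proof.
move=> /connectP[p0 ep0 ->]; case: (shortenP ep0) => p ep Up _.
have lt_pT : size p < #|T|.
  by have := max_card (mem (u :: p)); rewrite (card_uniqP Up).
have hasw : has (walkb u (last u p)) (iota 0 #|T|).
  apply/hasP; exists (size p); first by rewrite mem_iota.
  by apply/walkbP; exists p.
have := nth_find 0 hasw; rewrite nth_iota ?add0n; first by move/walkbP.
by rewrite -[X in _ < X](size_iota 0) -has_find.
Qed.

Lemma radio_labeling_exists :
  exists m, `[< exists f : T -> nat, radio_labeling f /\ label_span f = m >].
Proof.
pose f (u : T) : nat := enum_rank u * (diam + 1).
exists (label_span f); apply/asboolP; exists f; split=> // u v uv.
apply: leq_trans (leq_addl _ _).
rewrite /f !PoszM -GRing.mulrBl abszM absz_nat leq_pmull // absz_gt0.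
by rewrite GRing.subr_eq0 eqz_nat;
   apply: contra uv => /eqP/ord_inj/enum_rank_inj->.
Qed.

Definition radio_number : nat := ex_minn radio_labeling_exists.

Lemma radio_numberP (m : nat) :
  radio_number = m <->
  (exists f : T -> nat, radio_labeling f /\ label_span f = m) /\
  (forall f : T -> nat, radio_labeling f -> m <= label_span f).
Proof.
rewrite /radio_number; case: ex_minnP => r /asboolP rP rmin.
split=> [<-|[[f [fP fm]] mmin]].
  by split=> // f fP; apply: rmin; apply/asboolP; exists f.
apply/eqP; rewrite eqn_leq; apply/andP; split.
  by apply: rmin; apply/asboolP; exists f.
by case: rP => g [gP <-]; apply: mmin.
Qed.

End Radio.

(* Some j are the k leaves, None is the central vertex. *)
Definition star_vertex (k : nat) : finType := option 'I_k.

Definition star_edge (k : nat) : rel (star_vertex k) := fun x y =>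
  match x, y with
  | None, Some _ | Some _, None => true
  | _, _ => false
  end.

(* None is the root; Some (i, x) is the vertex x of the i-th copy of the
   (k-1)-star. *)
Definition banana_vertex (n k : nat) : finType :=
  option ('I_n * star_vertex (k - 1)).

(* The leaf joined to the root is the one numbered 0 in each copy. *)
Definition joined_leaf (k : nat) (x : star_vertex k) : bool :=
  if x is Some j then j == 0 :> nat else false.

Definition banana_edge (n k : nat) : rel (banana_vertex n k) := fun u v =>
  match u, v with
  | None, None => false
  | None, Some (_, x) | Some (_, x), None => joined_leaf x
  | Some (i, x), Some (j, y) => (i == j) && star_edge x y
  end.

Lemma banana_edge_sym (n k : nat) : symmetric (@banana_edge n k).
Proof.
move=> [[i x]|] [[j y]|] //=; rewrite eq_sym; congr (_ && _).
by case: x y => [?|] [?|].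
Qed.

Lemma banana_edge_irrefl (n k : nat) : irreflexive (@banana_edge n k).
Proof. by move=> [[i [x|]]|] //=; rewrite andbF. Qed.

Lemma banana_connected (n k : nat) : 1 < k ->
  forall u v : banana_vertex n k, connect (@banana_edge n k) u v.
Proof.
move=> k1; have k0 : 0 < k - 1 by rewrite subn_gt0.
have csym : connect_sym (@banana_edge n k).
  by apply: sym_connect_sym; apply: banana_edge_sym.
suff root u : connect (@banana_edge n k) None u.
  by move=> u v; apply: connect_trans (root v); rewrite csym.
case: u => [[i x]|]; last exact: connect0.
pose l : banana_vertex n k := Some (i, Some (Ordinal k0)).
pose c : banana_vertex n k := Some (i, None).
have cc : connect (@banana_edge n k) None c.
  by apply: (@connect_trans _ _ l); apply: connect1; rewrite //= eqxx.
case: x => [j|//]; apply: connect_trans cc _.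
by apply: connect1; rewrite /= eqxx.
Qed.

(* Main.v *)
Require Import Defs.
From mathcomp Require Import all_boot.
From mathcomp Require Import ssrint zify.

(** Let [L] be the distance to the root, so that [d(u, v) <= L u + L v], and
    order the vertices by label. Consecutive labels differ by at least
    [7 - L u - L v]; in the sum of these gaps every vertex is counted twice
    except the two extreme ones, one of which is not the root and has [L >= 1].
    This bounds the span below by [7 n k - 2 n (3 k - 3) + 1].

    All these inequalities become equalities for the following ordering: the
    root, then the pendant vertices, then the centres, then the vertices joined
    to the root, each kind being listed in rounds that visit the [n] branches
    cyclically. Since [n >= 5], two vertices of the same branch are always far
    enough apart in this ordering. *)

Set Implicit Arguments.
Unset Strict Implicit.
Unset Printing Implicit Defensive.

(** * A span bound for arbitrary graphs with a level function *)

Section Graph.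
Variables (T : finType) (e : rel T).

(** Along a shortest path [g] grows by at most one per step. Applied to a guessed distance from [u],
    this bounds [gdist] from below. *)
Lemma leq_gdist (g : T -> nat) (u v : T) :
  connect e u v -> (forall x y, e x y -> g y <= (g x).+1) ->
  g v <= g u + gdist e u v.
Proof.
move=> /gdistP[p [ep <- <-]] g_lip; elim: p u ep => [|x p IHp] u /=.
  by rewrite addn0.
by case/andP=> /g_lip gx /IHp; lia.
Qed.

(** The gaps telescope; [L x] and [L (last x s)] stand on the left because the two ends enter only
    one gap each. *)
Lemma sum_gaps_leq (f L : T -> nat) (D : nat) (x : T) (s : seq T) :
  (forall u v, u != v -> f u <= f v -> D + f u <= f v + (L u + L v)) ->
  path (relpre f leq) x s -> uniq (x :: s) ->
  D * size s + f x + L x + L (last x s)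
    <= f (last x s) + 2 * \sum_(v <- x :: s) L v.
Proof.
move=> gap; elim: s x => [|y s IHs] x; first by rewrite /= big_seq1; lia.
rewrite [path _ _ _]/= [uniq _]/= big_cons [last _ _]/= [size _]/=.
case/andP=> fxy /IHs IH /andP[]; rewrite inE negb_or => /andP[xy _] /IH.
by have := gap x y xy fxy; nia.
Qed.

Lemma label_span_ub (f : T -> nat) (u v : T) : `|f u - f v| <= label_span f.
Proof.
by apply: (bigmax_sup u) => //; apply: (bigmax_sup v).
Qed.

Lemma radio_span_lower_bound (f L : T -> nat) (r : T) :
  1 < #|T| -> (forall u v, gdist e u v <= L u + L v) ->
  (forall u, u != r -> 0 < L u) -> radio_labeling e f ->
  (diam e).+1 * #|T|.-1 + 1 <= label_span f + 2 * \sum_v L v.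
Proof.
move=> T_gt1 dL Lpos f_radio.
pose s := sort (relpre f leq) (enum T).
have s_sorted : sorted (relpre f leq) s by apply: sort_sorted => u v; apply: leq_total.
have s_uniq : uniq s by rewrite sort_uniq enum_uniq.
have size_s : size s = #|T| by rewrite size_sort cardE.
have sumL : \sum_(v <- s) L v = \sum_v L v.
  by rewrite -[RHS]big_enum; apply: perm_big; rewrite perm_sort.
rewrite -size_s in T_gt1 *.
move: s s_sorted s_uniq T_gt1 sumL {size_s} => [|x s] //.
move=> /= x_path x_uniq s_gt0 <-.
have gap u v : u != v -> f u <= f v -> (diam e).+1 + f u <= f v + (L u + L v).
  by move=> uv fuv; have := f_radio u v uv; have := dL u v; lia.
have := sum_gaps_leq gap x_path x_uniq.
have := label_span_ub f (last x s) x.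
(* The two ends are distinct, so at most one of them is [r]; this yields the final [+ 1]. *)
have : 0 < L x + L (last x s).
  have [xr|/Lpos] := eqVneq x r; last by lia.
  suff /Lpos: last x s != r by lia.
  case: s x_path x_uniq s_gt0 => [|y s] //.
  rewrite -xr => _ /andP[x_nin _] _; apply: contra x_nin => /eqP last_x.
  by rewrite -{1}last_x /= mem_last.
lia.
Qed.

End Graph.

(** * Levels, distances and diameter of the banana tree *)

Definition star_level (k : nat) (x : star_vertex k) : nat :=
  if x is Some j then (if j == 0 :> nat then 1 else 3) else 2.

Definition star_dist (k : nat) (x y : star_vertex k) : nat :=
  match x, y with
  | None, None => 0
  | Some i, Some j => if i == j then 0 else 2
  | _, _ => 1
  end.

Definition banana_level (n k : nat) (u : banana_vertex n k) : nat :=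
  if u is Some (_, x) then star_level x else 0.

Definition banana_dist (n k : nat) (u v : banana_vertex n k) : nat :=
  match u, v with
  | Some (i, x), Some (j, y) =>
      if i == j then star_dist x y else star_level x + star_level y
  | _, _ => banana_level u + banana_level v
  end.

Lemma banana_distxx (n k : nat) (u : banana_vertex n k) : banana_dist u u = 0.
Proof. by case: u => [[i [j|]]|] //=; rewrite !eqxx. Qed.

Lemma banana_dist_lipschitz (n k : nat) (u x y : banana_vertex n k) :
  banana_edge x y -> banana_dist u y <= (banana_dist u x).+1.
Proof.
case: x y u => [[i x]|] [[j y]|] [[h z]|] //=.
- case/andP=> /eqP <-; case: (h == i); case: x y z => [x|] [y|] [z|] //= _;
  by repeat case: ifP => //=; lia.
- by case/andP=> _; case: x y => [x|] [y|] //= _; case: ifP; lia.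
- case: x z => [x|] [z|] //= x0; rewrite x0; case: (h == i); try lia.
  case: (z =P x) => [->|_]; first by rewrite x0.
  by case: ifP.
- case: y z => [y|] [z|] //= y0; rewrite y0; case: (h == j); try lia.
  case: (z =P y) => [->|zy]; first by rewrite y0.
  by case: ifP => // z0; case: zy; apply: val_inj; lia.
- by case: y => [y|] //= ->.
Qed.

Lemma banana_dist_leq_gdist (n k : nat) (u v : banana_vertex n k) :
  1 < k -> banana_dist u v <= gdist (@banana_edge n k) u v.
Proof.
move=> k_gt1; rewrite -[gdist _ _ _]add0n -(banana_distxx u).
apply: leq_gdist (banana_connected k_gt1 u v) _ => x y.
exact: banana_dist_lipschitz.
Qed.

(** The walk from [u] up to the root and down to [v] has this length; inside one branch it need not
    be shortest. *)
Lemma gdist_leq_level (n k : nat) (u v : banana_vertex n k) :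
  1 < k ->
  gdist (@banana_edge n k) u v <= banana_level u + banana_level v.
Proof.
move=> k_gt1; have k0 : 0 < k - 1 by lia.
pose l (i : 'I_n) : banana_vertex n k := Some (i, Some (Ordinal k0)).
pose c (i : 'I_n) : banana_vertex n k := Some (i, None).
have up w : exists p : seq (banana_vertex n k),
    [/\ path (@banana_edge n k) w p, last w p = None & size p = banana_level w].
  case: w => [[i [j|]]|]; last by exists [::].
    rewrite /=; case: ifP => j0; first by exists [:: None]; rewrite /= j0.
    by exists [:: c i; l i; None]; rewrite /= !eqxx.
  by exists [:: l i; None]; rewrite /= !eqxx.
have down w : exists p : seq (banana_vertex n k),
    [/\ path (@banana_edge n k) None p, last None p = w & size p = banana_level w].
  case: w => [[i [j|]]|]; last by exists [::].
    rewrite /=; case: ifP => j0; first by exists [:: Some (i, Some j)]; rewrite /= j0.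
    by exists [:: l i; c i; Some (i, Some j)]; rewrite /= !eqxx.
  by exists [:: l i; c i]; rewrite /= !eqxx.
have [p [p_path p_last <-]] := up u; have [q [q_path q_last <-]] := down v.
rewrite -size_cat; apply: gdist_min.
  by rewrite cat_path p_path p_last.
by rewrite last_cat p_last.
Qed.

Lemma diam_banana (n k : nat) : 1 < n -> 2 < k -> diam (@banana_edge n k) = 6.
Proof.
move=> n_gt1 k_gt2; apply/eqP; rewrite eqn_leq; apply/andP; split.
  apply/bigmax_leqP => u _; apply/bigmax_leqP => v _.
  apply: leq_trans (gdist_leq_level u v _) _; first by lia.
  have level3 (w : banana_vertex n k) : banana_level w <= 3.
    by case: w => [[i [j|]]|] //=; case: ifP.
  exact: (leq_add (level3 u) (level3 v)).
have n0 : 0 < n by lia.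
have k1 : 1 < k - 1 by lia.
(* Index 1 gives a pendant vertex, at level 3; two of them in different branches realise the
   diameter. *)
pose p (i : 'I_n) : banana_vertex n k := Some (i, Some (Ordinal k1)).
apply: (bigmax_sup (p (Ordinal n0))) => //.
apply: (bigmax_sup (p (Ordinal n_gt1))) => //.
by apply: leq_trans (banana_dist_leq_gdist _ _ _); last lia.
Qed.

Lemma sum_option (I : finType) (F : option I -> nat) :
  \sum_x F x = F None + \sum_i F (Some i).
Proof.
rewrite (bigD1 None) //= (reindex_omap Some id) //=; last by case.
by congr (_ + _); apply: eq_bigl => i; rewrite eqxx.
Qed.

(** Each branch contributes [1 + 2 + 3 * (k - 2)]. *)
Lemma sum_banana_level (n k : nat) : 1 < k ->
  \sum_(v : banana_vertex n k) banana_level v = n * (3 * k - 3).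
Proof.
move=> k_gt1; rewrite sum_option add0n.
rewrite (eq_bigr (fun p => star_level p.2)) => [|[] //].
rewrite -(pair_bigA _ (fun (i : 'I_n) (x : star_vertex (k - 1)) => star_level x)) /=.
rewrite sum_nat_const card_ord; congr (_ * _); rewrite sum_option /=.
case: k k_gt1 => [//|[//|k]] _; rewrite subn1 big_ord_recl /=.
by rewrite sum_nat_const card_ord; lia.
Qed.

(* The gaps are 1 between pendant vertices, 3 between centres, 5 between joined
   leaves; the joined leaf has number 0, so pendant round [j] starts at [j = 1]. *)
Definition banana_label (n k : nat) (u : banana_vertex n k) : nat :=
  match u with
  | None => 0
  | Some (i, None) => (k - 2) * n + 5 + 3 * i
  | Some (i, Some j) =>
      if j == 0 :> nat then (k - 2) * n + 3 * n + 6 + 5 * i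
      else 4 + j.-1 * n + i
  end.

(** The bound is the label of the joined leaf of the last branch, [i = n - 1]. *)
Lemma banana_label_leq (n k : nat) (u : banana_vertex n k) :
  1 < k -> banana_label u <= n * (k + 6) + 1.
Proof.
move=> k_gt1; case: u => [[i [j|]]|] //=.
- by case: ifP => _; have := ltn_ord i; have := ltn_ord j; nia.
- by have := ltn_ord i; nia.
Qed.

Lemma banana_label_radio (n k : nat) : 5 <= n -> 4 <= k ->
  radio_labeling (@banana_edge n k) (@banana_label n k).
Proof.
move=> hn hk u v uv; rewrite diam_banana; try lia.
have k_gt1 : 1 < k by lia.
apply: leq_trans (leq_add (banana_dist_leq_gdist u v k_gt1) (leqnn _)).
(* Every full pendant round ends before the centres begin. *)
have last_round (j : 'I_(k - 1)) : (j == 0 :> nat) = false ->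
    j.-1 * n + n <= (k - 2) * n.
  by move=> j0; rewrite -mulSnr leq_mul2r; have := ltn_ord j; lia.
case: u v uv => [[i x]|] [[i' y]|] //= uv.
- have [ii|ne_ii] := eqVneq i i'.
    subst i'; have ne_xy : x != y by apply: contra uv => /eqP ->.
    case: x y ne_xy {uv} => [x|] [y|] //= ne_xy.
    + have {}ne_xy : x != y by [].
      rewrite (negPf ne_xy).
      have {}ne_xy : x != y :> nat by [].
      case: ifP => x0; case: ifP => y0; first by lia.
      * by have := last_round _ y0; lia.
      * by have := last_round _ x0; lia.
      (* Pendant vertices of one branch are at distance 2 and lie in different rounds, so their
         labels differ by at least [n >= 5]. *)
      * have : x.-1 < y.-1 \/ y.-1 < x.-1 by lia.
        by case=> xy; have := leq_mul xy (leqnn n); rewrite mulSn; lia.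
    + by case: ifP => x0; [|have := last_round _ x0]; lia.
    + by case: ifP => y0; [|have := last_round _ y0]; lia.
  have {}ne_ii : i != i' :> nat by [].
  have := ltn_ord i; have := ltn_ord i'.
  case: x y {uv} => [x|] [y|] /=; try lia.
  + case: ifP => x0; case: ifP => y0; first by lia.
    * by have := last_round _ y0; lia.
    * by have := last_round _ x0; lia.
    (* At distance 6 distinct labels suffice, and these differ modulo [n]. *)
    * move=> ltn_i' ltn_i; suff: x.-1 * n + i != y.-1 * n + i' by lia.
      apply: contra ne_ii => /eqP/(congr1 (modn^~ n)).
      by rewrite !modnMDl !modn_small // => ->.
  + by case: ifP => x0; [|have := last_round _ x0]; lia.
  + by case: ifP => y0; [|have := last_round _ y0]; lia.
- by case: x {uv} => [x|] /=; [case: ifP => _|]; nia.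
- by case: y {uv} => [y|] /=; [case: ifP => _|]; nia.
Qed.

Theorem theorem4p1 (n k : nat) (hn : 5 <= n) (hk : 4 <= k) :
  radio_number (@banana_edge n k) = n * (k + 6) + 1.
Proof.
have k_gt1 : 1 < k by lia.
have lower f : radio_labeling (@banana_edge n k) f ->
    n * (k + 6) + 1 <= label_span f.
  move=> f_radio.
  have card : #|banana_vertex n k| = (n * k).+1.
    by rewrite card_option card_prod card_option !card_ord; congr (_ * _).+1; lia.
  have card_gt1 : 1 < #|banana_vertex n k| by rewrite card; nia.
  have level_gt0 (u : banana_vertex n k) : u != None -> 0 < banana_level u.
    by case: u => [[i [j|]]|] //= _; case: ifP.
  have := radio_span_lower_bound card_gt1
            (fun u v => gdist_leq_level u v k_gt1) level_gt0 f_radio.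
  (* [7 * n * k + 1 - 2 * n * (3 * k - 3) = n * (k + 6) + 1]. *)
  by rewrite card diam_banana ?sum_banana_level //; nia.
apply/radio_numberP; split=> //; exists (@banana_label n k).
have radio := banana_label_radio hn hk; split=> //.
apply/eqP; rewrite eqn_leq lower // andbT.
apply/bigmax_leqP => u _; apply/bigmax_leqP => v _.
by have := banana_label_leq u k_gt1; have := banana_label_leq v k_gt1; lia.
Qed.
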